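(* Suppose $A\subseteq 2^\omega$ is a Turing independent set of reals which contains a perfect set $A'$, $B$ is a countable dense subset of $A'$, and $x\in 2^\omega$ computes every element of $B$. Then $(A\setminus B)\cup\{x\}$ is not Turing independent.
   Context: A set $A\subseteq 2^\omega$ is Turing independent if whenever $a_0,\ldots,a_n\in A$ and $b\in A$ is not equal to any $a_i$, then $a_0\oplus\cdots\oplus a_n$ does not compute $b$ (i.e. $b\not\leq_T a_0\oplus\cdots\oplus a_n$). A perfect set is a nonempty closed subset of $2^\omega$ with no isolated points; ''dense subset of $A'$'' refers to the subspace topology on $A'$. *)

(* Defs.v *)
From Stdlib Require Import List Arith.
Import ListNotations.

Definition real := nat -> bool.
Definition rset := real -> Prop.

Inductive prf : Type :=
| PZero : prf
| PSucc : prf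
| PProj : nat -> prf
| POracle : prf
| PComp : prf -> list prf -> prf
| PRec : prf -> prf -> prf
| PMin : prf -> prf.

Definition b2n (b : bool) : nat := if b then 1 else 0.

Inductive eval (X : real) : prf -> list nat -> nat -> Prop :=
| ev_zero : forall args, eval X PZero args 0
| ev_succ : forall args, eval X PSucc args (S (hd 0 args))
| ev_proj : forall i args, eval X (PProj i) args (nth i args 0)
| ev_oracle : forall args, eval X POracle args (b2n (X (hd 0 args)))
| ev_comp : forall f gs args ys v,
    evals X gs args ys -> eval X f ys v -> eval X (PComp f gs) args v
| ev_rec0 : forall f g rest v,
    eval X f rest v -> eval X (PRec f g) (0 :: rest) v
| ev_recS : forall f g n rest y v,
    eval X (PRec f g) (n :: rest) y -> eval X g (n :: y :: rest) v ->
    eval X (PRec f g) (S n :: rest) v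
| ev_min : forall f args n,
    msearch X f args 0 n -> eval X (PMin f) args n
with evals (X : real) : list prf -> list nat -> list nat -> Prop :=
| evs_nil : forall args, evals X [] args []
| evs_cons : forall g gs args y ys,
    eval X g args y -> evals X gs args ys -> evals X (g :: gs) args (y :: ys)
with msearch (X : real) : prf -> list nat -> nat -> nat -> Prop :=
| ms_found : forall f args m,
    eval X f (m :: args) 0 -> msearch X f args m m
| ms_next : forall f args m k n,
    eval X f (m :: args) (S k) -> msearch X f args (S m) n -> msearch X f args m n.

Definition turing_le (b a : real) : Prop :=
  exists p : prf, forall n : nat, eval a p [n] (b2n (b n)).

Definition join (a b : real) : real :=
  fun n => if Nat.even n then a (Nat.div2 n) else b (Nat.div2 n).

Fixpoint joinl (a0 : real) (l : list real) : real :=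
  match l with
  | [] => a0
  | a1 :: l' => join a0 (joinl a1 l')
  end.

Definition turing_independent (A : rset) : Prop :=
  forall (a0 : real) (l : list real) (b : real),
    A a0 -> (forall a, In a l -> A a) -> A b ->
    b <> a0 -> ~ In b l ->
    ~ turing_le b (joinl a0 l).

(* ---------- Topology of Cantor space (basic opens = finite prefixes) ---------- *)
Definition agree_upto (n : nat) (x y : real) : Prop :=
  forall m, m < n -> x m = y m.

Definition closed_set (P : rset) : Prop :=
  forall x, (forall n, exists y, P y /\ agree_upto n x y) -> P x.

Definition perfect_set (P : rset) : Prop :=
  (exists x, P x) /\ closed_set P /\
  (forall x, P x -> forall n, exists y, P y /\ y <> x /\ agree_upto n x y).

Definition subset (P Q : rset) : Prop := forall x, P x -> Q x.

Definition countable_set (B : rset) : Prop :=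
  exists f : nat -> real, forall y, B y -> exists k, f k = y.

Definition dense_in (B A' : rset) : Prop :=
  subset B A' /\
  (forall x, A' x -> forall n, exists y, B y /\ agree_upto n x y).

(* Main.v *)
(* Any real y can be computed from x together with four elements c0, c1, c2, c3 of
   the perfect set. Each c_i is a limit of x-computable elements b of A': it follows
   such a b, leaves it at a late branching of A', and goes on along another one.
   The pairs (c0,c1) and (c2,c3) alternate. A decoder that knows x-indices of the two
   reals which the active pair follows finds the positions k, k' where the pair
   leaves them. The order of k and k' codes one bit of y. With M = min(k,k') and
   N = max(k,k') chosen large enough, the least index that within N steps reproduces
   the first M bits of a member of the other pair is a correct index of the real
   which that member follows, so the other pair can become active.

   Applied to some y not computable from x, this shows that A' has an element y not
   computable from x. Applied to that y, with the c_i in a cylinder avoiding y, it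
   makes y computable from x and those c_i that x does not compute; all of these
   are outside B. *)
From Stdlib Require Import List Arith Lia Bool Cantor.
From Stdlib Require Import Classical ClassicalEpsilon FunctionalExtensionality.
Import ListNotations.
Require Import Defs.

(** * Functions computable relative to an oracle: closure properties *)

Definition computable (X : real) (k : nat) (F : list nat -> nat) : Prop :=
  exists p, forall a, length a = k -> eval X p a (F a).

Create HintDb comp discriminated.
#[local] Hint Constants Opaque : comp.
#[local] Hint Variables Opaque : comp.

Lemma computable_ext X k F G :
  (forall a, length a = k -> F a = G a) -> computable X k F -> computable X k G.
Proof.
  intros H [p Hp]; exists p; intros a Ha. rewrite <- H by exact Ha. auto.
Qed.

Lemma computable_nth X k i : computable X k (fun a => nth i a 0).
Proof. exists (PProj i); intros; constructor. Qed.

Lemma evals_projections X a i n :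
  i + n = length a -> evals X (map PProj (seq i n)) a (skipn i a).
Proof.
  revert i; induction n as [|n IH]; intros i H; cbn.
  - rewrite skipn_all2 by lia. constructor.
  - assert (E : skipn i a = nth i a 0 :: skipn (S i) a).
    { clear IH. revert i H; induction a as [|h a IHa]; intros [|i] H; cbn in *; try lia; auto with arith. }
    rewrite E. constructor; [constructor | apply IH; lia].
Qed.

Lemma computable_tl X k F : computable X k F -> computable X (S k) (fun a => F (tl a)).
Proof.
  intros [p Hp]. exists (PComp p (map PProj (seq 1 k))). intros a Ha.
  econstructor; [apply evals_projections; lia|].
  destruct a; [discriminate|]. apply Hp. cbn in *; lia.
Qed.

Lemma computable_comp1 X k f F :
  computable X 1 (fun a => f (nth 0 a 0)) -> computable X k F ->
  computable X k (fun a => f (F a)).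
Proof.
  intros [p Hp] [q Hq]. exists (PComp p [q]). intros a Ha.
  econstructor; [repeat econstructor; eauto | apply (Hp [F a]); reflexivity].
Qed.

Lemma computable_comp2 X k f F G :
  computable X 2 (fun a => f (nth 0 a 0) (nth 1 a 0)) ->
  computable X k F -> computable X k G ->
  computable X k (fun a => f (F a) (G a)).
Proof.
  intros [p Hp] [q Hq] [r Hr]. exists (PComp p [q; r]). intros a Ha.
  econstructor; [repeat econstructor; eauto | apply (Hp [F a; G a]); reflexivity].
Qed.

Lemma computable_comp3 X k f F G H :
  computable X 3 (fun a => f (nth 0 a 0) (nth 1 a 0) (nth 2 a 0)) ->
  computable X k F -> computable X k G -> computable X k H ->
  computable X k (fun a => f (F a) (G a) (H a)).
Proof.
  intros [p Hp] [q Hq] [r Hr] [s Hs]. exists (PComp p [q; r; s]). intros a Ha.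
  econstructor; [repeat econstructor; eauto | apply (Hp [F a; G a; H a]); reflexivity].
Qed.

Lemma computable_S X k F : computable X k F -> computable X k (fun a => S (F a)).
Proof.
  apply computable_comp1. exists PSucc. intros [|n a] H; [discriminate|]. apply ev_succ.
Qed.

Lemma computable_0 X k : computable X k (fun _ => 0).
Proof. exists PZero; intros; constructor. Qed.

Lemma computable_const X k n : computable X k (fun _ => n).
Proof.
  induction n; [apply computable_0 | apply (computable_S X k (fun _ => n)); assumption].
Qed.

(** The order counter, previous value, parameters is that of [ev_recS]. *)
Lemma computable_rec X k (N F : list nat -> nat) (G : nat -> nat -> list nat -> nat) :
  computable X k N -> computable X k F ->
  computable X (S (S k)) (fun a => G (nth 0 a 0) (nth 1 a 0) (tl (tl a))) ->
  computable X k (fun a => nat_rec (fun _ => nat) (F a) (fun n y => G n y a) (N a)).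
Proof.
  intros [pN HN] [pF HF] [pG HG].
  exists (PComp (PRec pF pG) (pN :: map PProj (seq 0 k))). intros a Ha.
  econstructor; [constructor; [apply HN, Ha | apply (evals_projections X a 0 k); lia]|].
  cbn [skipn]. induction (N a) as [|n IH]; cbn.
  - constructor; auto.
  - econstructor; [exact IH|].
    apply (HG (n :: nat_rec (fun _ => nat) (F a) (fun n y => G n y a) n :: a)). cbn; lia.
Qed.

Lemma msearch_least X p a n (f : nat -> nat) :
  (forall i, i <= n -> eval X p (i :: a) (f i)) ->
  f n = 0 -> (forall i, i < n -> f i <> 0) -> msearch X p a 0 n.
Proof.
  intros Hp H0 Hpos.
  assert (H : forall d i, i + d = n -> msearch X p a i n).
  { induction d as [|d IH]; intros i Hi.
    - replace i with n by lia. apply ms_found. rewrite <- H0. apply Hp; lia.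
    - destruct (f i) as [|v] eqn:E; [exfalso; apply (Hpos i); auto; lia|].
      apply ms_next with v; [rewrite <- E; apply Hp; lia | apply IH; lia]. }
  apply (H n 0); lia.
Qed.

(** This is the entry point of unbounded search: [m] may be any function, obtained by choice for
    instance, once it is characterized as a least zero. *)
Lemma computable_least X k (m : list nat -> nat) (F : nat -> list nat -> nat) :
  computable X (S k) (fun a => F (nth 0 a 0) (tl a)) ->
  (forall a, length a = k -> F (m a) a = 0 /\ forall i, i < m a -> F i a <> 0) ->
  computable X k m.
Proof.
  intros [p Hp] H. exists (PMin p). intros a Ha. destruct (H a Ha) as [H0 Hpos].
  constructor. apply msearch_least with (f := fun i => F i a); auto.
  intros i _. apply (Hp (i :: a)). cbn; lia.
Qed.

Lemma computable_nth_tl X k i : computable X (S k) (fun a => nth i (tl a) 0).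
Proof. apply (computable_tl X k (fun a => nth i a 0)), computable_nth. Qed.

Lemma computable_nth_tl2 X k i : computable X (S (S k)) (fun a => nth i (tl (tl a)) 0).
Proof. apply (computable_tl X (S k) (fun a => nth i (tl a) 0)), computable_nth_tl. Qed.

Lemma computable_nth_tl3 X k i : computable X (S (S (S k))) (fun a => nth i (tl (tl (tl a))) 0).
Proof. apply (computable_tl X (S (S k)) (fun a => nth i (tl (tl a)) 0)), computable_nth_tl2. Qed.

#[local] Hint Resolve computable_nth computable_nth_tl computable_nth_tl2 computable_nth_tl3 : comp.
#[local] Hint Resolve computable_S computable_const : comp.
(** The hints are closure rules selected by the shape of the function body; constants are opaque in
    the database so that matching stays syntactic. *)
Ltac comp := eauto 2000 with comp nocore.

Lemma computable_pred X k F : computable X k F -> computable X k (fun a => pred (F a)).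
Proof.
  apply computable_comp1.
  apply computable_ext with
    (F := fun a => nat_rec (fun _ => nat) 0 (fun n _ => n) (nth 0 a 0)).
  - intros a _. destruct (nth 0 a 0); reflexivity.
  - apply (computable_rec X 1 _ (fun _ => 0) (fun n _ _ => n)); comp.
Qed.
#[local] Hint Resolve computable_pred : comp.

Lemma computable_add X k F G :
  computable X k F -> computable X k G -> computable X k (fun a => F a + G a).
Proof.
  apply computable_comp2.
  apply computable_ext with
    (F := fun a => nat_rec (fun _ => nat) (nth 0 a 0) (fun _ y => S y) (nth 1 a 0)).
  - intros a _. induction (nth 1 a 0); cbn; lia.
  - apply (computable_rec X 2 _ _ (fun _ y _ => S y)); comp.
Qed.

Lemma computable_sub X k F G :
  computable X k F -> computable X k G -> computable X k (fun a => F a - G a).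
Proof.
  apply computable_comp2.
  apply computable_ext with
    (F := fun a => nat_rec (fun _ => nat) (nth 0 a 0) (fun _ y => pred y) (nth 1 a 0)).
  - intros a _. induction (nth 1 a 0); cbn; lia.
  - apply (computable_rec X 2 _ _ (fun _ y _ => pred y)); comp.
Qed.
#[local] Hint Resolve computable_add computable_sub : comp.

Lemma computable_if X k B F G :
  computable X k (fun a => b2n (B a)) -> computable X k F -> computable X k G ->
  computable X k (fun a => if B a then F a else G a).
Proof.
  intros HB HF HG.
  apply computable_ext with
    (F := fun a => nat_rec (fun _ => nat) (G a) (fun _ _ => F a) (b2n (B a))).
  - intros a _. destruct (B a); reflexivity.
  - apply (computable_rec X k (fun a => b2n (B a)) G (fun _ _ a => F a)); [comp..|].
    apply (computable_tl X (S k) (fun a => F (tl a))), computable_tl, HF.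
Qed.
#[local] Hint Resolve computable_if : comp.

Lemma computable_eqb X k F G :
  computable X k F -> computable X k G -> computable X k (fun a => b2n (F a =? G a)).
Proof.
  intros HF HG.
  apply computable_ext with (F := fun a => 1 - ((F a - G a) + (G a - F a))); [|comp].
  intros a _. destruct (Nat.eqb_spec (F a) (G a)); cbn [b2n]; lia.
Qed.

Lemma computable_ltb X k F G :
  computable X k F -> computable X k G -> computable X k (fun a => b2n (F a <? G a)).
Proof.
  intros HF HG.
  apply computable_ext with (F := fun a => 1 - (S (F a) - G a)); [|comp].
  intros a _. destruct (Nat.ltb_spec (F a) (G a)); cbn [b2n]; lia.
Qed.

Lemma computable_negb X k B :
  computable X k (fun a => b2n (B a)) -> computable X k (fun a => b2n (negb (B a))).
Proof.
  intros HB. apply computable_ext with (F := fun a => 1 - b2n (B a)); [|comp].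
  intros a _. destruct (B a); reflexivity.
Qed.

Lemma computable_andb X k B C :
  computable X k (fun a => b2n (B a)) -> computable X k (fun a => b2n (C a)) ->
  computable X k (fun a => b2n (B a && C a)).
Proof.
  intros HB HC. apply computable_ext with (F := fun a => if B a then b2n (C a) else 0); [|comp].
  intros a _. destruct (B a); reflexivity.
Qed.
#[local] Hint Resolve computable_eqb computable_ltb computable_negb computable_andb : comp.

(** * Bounded quantifiers *)

Definition ball (n : nat) (f : nat -> bool) : bool :=
  nat_rec (fun _ => bool) true (fun i b => b && f i) n.
Definition bex (n : nat) (f : nat -> bool) : bool := negb (ball n (fun i => negb (f i))).

Lemma ball_spec n f : ball n f = true <-> forall i, i < n -> f i = true.
Proof.
  induction n as [|n IH]; cbn.
  - split; [lia|reflexivity].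
  - rewrite andb_true_iff. fold (ball n f). rewrite IH. split.
    + intros [H1 H2] i Hi. destruct (Nat.eq_dec i n) as [->|]; [exact H2|apply H1; lia].
    + intros H; split; [intros i Hi|]; apply H; lia.
Qed.

Lemma bex_spec n f : bex n f = true <-> exists i, i < n /\ f i = true.
Proof.
  unfold bex. rewrite negb_true_iff, <- not_true_iff_false, ball_spec. split.
  - intros H. apply not_all_ex_not in H as [i H]. apply imply_to_and in H as [Hi H].
    exists i. destruct (f i); auto.
  - intros (i & Hi & H) H'. specialize (H' i Hi). rewrite H in H'. discriminate.
Qed.

Lemma computable_ball X k N (P : nat -> list nat -> bool) :
  computable X k N -> computable X (S k) (fun a => b2n (P (nth 0 a 0) (tl a))) ->
  computable X k (fun a => b2n (ball (N a) (fun i => P i a))).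
Proof.
  intros HN HP.
  apply computable_ext with
    (F := fun a => nat_rec (fun _ => nat) 1 (fun n y => if y =? 1 then b2n (P n a) else 0) (N a)).
  - intros a _. induction (N a) as [|n IH]; cbn; [reflexivity|].
    fold (ball n (fun i => P i a)). rewrite IH.
    destruct (ball n (fun i => P i a)); reflexivity.
  - apply (computable_rec X k N (fun _ => 1) (fun n y a => if y =? 1 then b2n (P n a) else 0)); [comp..|].
    apply computable_if; [comp| |comp].
    destruct HP as [p Hp].
    (* The recursion step receives the running value as argument 1, which [P] does not take; the
       projections skip it. *)
    exists (PComp p (PProj 0 :: map PProj (seq 2 k))). intros a Ha.
    econstructor; [constructor; [constructor | apply evals_projections; lia]|].
    destruct a as [|h [|h' a]]; try discriminate. apply (Hp (h :: a)). cbn in *; lia.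
Qed.
#[local] Hint Resolve computable_ball : comp.

Lemma computable_bex X k N (P : nat -> list nat -> bool) :
  computable X k N -> computable X (S k) (fun a => b2n (P (nth 0 a 0) (tl a))) ->
  computable X k (fun a => b2n (bex (N a) (fun i => P i a))).
Proof.
  intros HN HP. unfold bex. apply computable_negb.
  apply (computable_ball X k N (fun i a => negb (P i a))); [exact HN|].
  apply (computable_negb X (S k) (fun a => P (nth 0 a 0) (tl a))), HP.
Qed.
#[local] Hint Resolve computable_bex : comp.

(** * Cantor pairing *)

Definition npair (a b : nat) : nat := to_nat (a, b).
Definition pfst (n : nat) : nat := fst (of_nat n).
Definition psnd (n : nat) : nat := snd (of_nat n).

Lemma pfst_pair a b : pfst (npair a b) = a.
Proof. unfold pfst, npair. rewrite cancel_of_to. reflexivity. Qed.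

Lemma psnd_pair a b : psnd (npair a b) = b.
Proof. unfold psnd, npair. rewrite cancel_of_to. reflexivity. Qed.

Lemma pair_eta n : npair (pfst n) (psnd n) = n.
Proof. unfold pfst, psnd, npair. rewrite <- surjective_pairing. apply cancel_to_of. Qed.

Lemma pair_le a b : b + a <= npair a b.
Proof. apply to_nat_non_decreasing. Qed.

Lemma computable_pair X k F G :
  computable X k F -> computable X k G -> computable X k (fun a => npair (F a) (G a)).
Proof.
  apply (computable_comp2 X k npair).
  (* By definition, Cantor's code of a pair is its second component plus the triangular number of
     the sum of both components; the recursion computes that triangular number. *)
  apply computable_add; [comp|].
  apply (computable_rec X 2 (fun a => nth 1 a 0 + nth 0 a 0) (fun _ => 0) (fun i m _ => S i + m)); comp.
Qed.
#[local] Hint Resolve computable_pair : comp.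

(** A code bounds its second component, so a bounded quantifier recognizes the first one, and a
    search for the least candidate finds it. *)
Lemma computable_pfst X k F : computable X k F -> computable X k (fun a => pfst (F a)).
Proof.
  apply (computable_comp1 X k pfst).
  apply computable_least with
    (F := fun i a => b2n (negb (bex (S (nth 0 a 0)) (fun j => npair i j =? nth 0 a 0)))); [comp|].
  intros a _. set (n := nth 0 a 0). split.
  - replace (bex _ _) with true; [reflexivity|]. symmetry. apply bex_spec.
    exists (psnd n). rewrite pair_eta, Nat.eqb_refl. split; [|reflexivity].
    pose proof (pair_le (pfst n) (psnd n)). rewrite pair_eta in H. lia.
  - intros i Hi. destruct (bex _ _) eqn:E; [|discriminate].
    apply bex_spec in E as (j & _ & E). apply Nat.eqb_eq in E.
    rewrite <- E, pfst_pair in Hi. lia.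
Qed.

Lemma computable_psnd X k F : computable X k F -> computable X k (fun a => psnd (F a)).
Proof.
  apply (computable_comp1 X k psnd).
  apply computable_least with
    (F := fun j a => b2n (negb (npair (pfst (nth 0 a 0)) j =? nth 0 a 0))).
  - pose proof computable_pfst. comp.
  - intros a _. set (n := nth 0 a 0). split.
    + rewrite pair_eta, Nat.eqb_refl. reflexivity.
    + intros j Hj. destruct (Nat.eqb_spec (npair (pfst n) j) n) as [E|]; [|discriminate].
      rewrite <- E, psnd_pair in Hj. lia.
Qed.
#[local] Hint Resolve computable_pfst computable_psnd : comp.

Lemma computable_min X k F G :
  computable X k F -> computable X k G -> computable X k (fun a => Nat.min (F a) (G a)).
Proof.
  intros HF HG. apply computable_ext with (F := fun a => F a - (F a - G a)); [|comp].
  intros; lia.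
Qed.

Lemma computable_max X k F G :
  computable X k F -> computable X k G -> computable X k (fun a => Nat.max (F a) (G a)).
Proof.
  intros HF HG. apply computable_ext with (F := fun a => F a + (G a - F a)); [|comp].
  intros; lia.
Qed.
#[local] Hint Resolve computable_min computable_max : comp.

(** * Codes of lists and programs *)

Definition lcons (h t : nat) : nat := S (npair h t).
Definition lhd (l : nat) : nat := pfst (pred l).
Definition ltl (l : nat) : nat := psnd (pred l).
Definition lnth (i l : nat) : nat := lhd (nat_rec (fun _ => nat) l (fun _ y => ltl y) i).

Fixpoint enc (l : list nat) : nat :=
  match l with [] => 0 | h :: t => lcons h (enc t) end.

Lemma lhd_lcons h t : lhd (lcons h t) = h.
Proof. apply pfst_pair. Qed.

Lemma ltl_lcons h t : ltl (lcons h t) = t.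
Proof. apply psnd_pair. Qed.

(** The successor in [lcons] reserves [0] for the empty list. Since [0] also codes the pair of
    zeros, [lhd] and [ltl] map [0] to [0], in accordance with the defaults of [hd] and [nth] in
    [eval]. *)
Lemma lhd_enc l : lhd (enc l) = hd 0 l.
Proof. destruct l; [reflexivity | apply lhd_lcons]. Qed.

Lemma lnth_enc i l : lnth i (enc l) = nth i l 0.
Proof.
  assert (H : nat_rec (fun _ => nat) (enc l) (fun _ y => ltl y) i = enc (skipn i l)).
  { induction i as [|i IH]; [reflexivity|]. cbn [nat_rec nat_rect]. fold (nat_rec (fun _ => nat)).
    transitivity (ltl (enc (skipn i l))); [f_equal; exact IH|].
    clear. revert i; induction l as [|h l IH]; intros [|i]; try reflexivity.
    - apply ltl_lcons.
    - apply IH. }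
  unfold lnth. rewrite H, lhd_enc. clear H.
  revert i; induction l as [|h l IH]; intros [|i]; try reflexivity. apply IH.
Qed.

(** The inner fixpoint makes the recursion through the nested list structural; [code_PComp] replaces
    it by [codes]. *)
Fixpoint code (p : prf) : nat :=
  match p with
  | PZero => npair 0 0
  | PSucc => npair 1 0
  | PProj i => npair 2 i
  | POracle => npair 3 0
  | PComp f gs =>
      npair 4 (npair (code f)
        ((fix codes l := match l with [] => 0 | g :: l' => lcons (code g) (codes l') end) gs))
  | PRec f g => npair 5 (npair (code f) (code g))
  | PMin f => npair 6 (code f)
  end.

Definition codes (gs : list prf) : nat := enc (map code gs).

Lemma code_PComp f gs : code (PComp f gs) = npair 4 (npair (code f) (codes gs)).
Proof.
  cbn [code]. do 2 f_equal. unfold codes. induction gs; cbn; congruence.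
Qed.

Lemma codes_cons g gs : codes (g :: gs) = lcons (code g) (codes gs).
Proof. reflexivity. Qed.

(** * A universal stack machine *)

(* A state evaluates a program, evaluates a list of programs, or returns a value
   (an encoded list, in the second case) to the top frame of the stack [K]. *)
Definition st_eval (p args K : nat) : nat := npair 0 (npair p (npair args K)).
Definition st_ret (v K : nat) : nat := npair 1 (npair v K).
Definition st_list (gs args K : nat) : nat := npair 2 (npair gs (npair args K)).

(** A frame of tag 0 holds the programs of a list still to be run, tag 1 a computed head awaiting
    its tail, tag 2 the outer program of a composition, tag 3 the step program of a recursion, tag 4
    a search with its current candidate. *)
Definition push (tag d K : nat) : nat := lcons (npair tag d) K.

Definition step_eval (x : real) (p args K : nat) : nat :=
  if pfst p =? 0 then st_ret 0 K
  else if pfst p =? 1 then st_ret (S (lhd args)) K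
  else if pfst p =? 2 then st_ret (lnth (psnd p) args) K
  else if pfst p =? 3 then st_ret (b2n (x (lhd args))) K
  else if pfst p =? 4 then st_list (psnd (psnd p)) args (push 2 (pfst (psnd p)) K)
  else if pfst p =? 5 then
    if lhd args =? 0 then st_eval (pfst (psnd p)) (ltl args) K
    else st_eval p (lcons (pred (lhd args)) (ltl args))
           (push 3 (npair (psnd (psnd p)) (npair (pred (lhd args)) (ltl args))) K)
  else st_eval (psnd p) (lcons 0 args) (push 4 (npair (psnd p) (npair args 0)) K).

Definition step_list (gs args K : nat) : nat :=
  if gs =? 0 then st_ret 0 K
  else st_eval (lhd gs) args (push 0 (npair (ltl gs) args) K).

Definition step_frame (v tag d K : nat) : nat :=
  if tag =? 0 then st_list (pfst d) (psnd d) (push 1 v K)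
  else if tag =? 1 then st_ret (lcons d v) K
  else if tag =? 2 then st_eval d v K
  else if tag =? 3 then st_eval (pfst d) (lcons (pfst (psnd d)) (lcons v (psnd (psnd d)))) K
  else if v =? 0 then st_ret (psnd (psnd d)) K
  else st_eval (pfst d) (lcons (S (psnd (psnd d))) (pfst (psnd d)))
         (push 4 (npair (pfst d) (npair (pfst (psnd d)) (S (psnd (psnd d))))) K).

(** A value returned to the empty stack is a fixed point, so a halted run keeps its result at all
    later times. *)
Definition step (x : real) (c : nat) : nat :=
  if pfst c =? 0 then step_eval x (pfst (psnd c)) (pfst (psnd (psnd c))) (psnd (psnd (psnd c)))
  else if pfst c =? 2 then step_list (pfst (psnd c)) (pfst (psnd (psnd c))) (psnd (psnd (psnd c)))
  else if psnd (psnd c) =? 0 then c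
  else step_frame (pfst (psnd c)) (pfst (lhd (psnd (psnd c)))) (psnd (lhd (psnd (psnd c))))
         (ltl (psnd (psnd c))).

Definition run (x : real) (t c : nat) : nat := nat_rec (fun _ => nat) c (fun _ y => step x y) t.

Lemma step_st_eval x p args K : step x (st_eval p args K) = step_eval x p args K.
Proof. unfold step, st_eval. rewrite !psnd_pair, !pfst_pair. reflexivity. Qed.

Lemma step_st_list x gs args K : step x (st_list gs args K) = step_list gs args K.
Proof. unfold step, st_list. rewrite !psnd_pair, !pfst_pair. reflexivity. Qed.

Lemma step_st_ret x v tag d K : step x (st_ret v (push tag d K)) = step_frame v tag d K.
Proof.
  unfold step, st_ret, push. rewrite !psnd_pair, !pfst_pair, lhd_lcons, ltl_lcons, pfst_pair, psnd_pair.
  reflexivity.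
Qed.

Lemma step_halted x v : step x (st_ret v 0) = st_ret v 0.
Proof. unfold step, st_ret. rewrite !psnd_pair, !pfst_pair. reflexivity. Qed.

Lemma run_add x s t c : run x (s + t) c = run x s (run x t c).
Proof.
  induction s as [|s IH]; [reflexivity|]. exact (f_equal (step x) IH).
Qed.

Definition reaches (x : real) (c c' : nat) : Prop := exists t, run x t c = c'.

Lemma reaches_trans x c1 c2 c3 : reaches x c1 c2 -> reaches x c2 c3 -> reaches x c1 c3.
Proof. intros [s <-] [t <-]. exists (t + s). apply run_add. Qed.

Lemma reaches_step x c c' : reaches x (step x c) c' -> reaches x c c'.
Proof. apply reaches_trans. exists 1. reflexivity. Qed.

Lemma reaches_refl x c : reaches x c c.
Proof. exists 0. reflexivity. Qed.

Scheme eval_mut := Minimality for eval Sort Prop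
  with evals_mut := Minimality for evals Sort Prop
  with msearch_mut := Minimality for msearch Sort Prop.

Ltac machine_step :=
  apply reaches_step; first [rewrite step_st_eval | rewrite step_st_list | rewrite step_st_ret];
  unfold step_eval, step_list, step_frame; rewrite ?code_PComp; cbn [enc code];
  repeat rewrite ?codes_cons, ?pfst_pair, ?psnd_pair, ?lhd_lcons, ?ltl_lcons;
  cbn [Nat.eqb].

(** Mutual induction on the three evaluation judgments, for all stacks at once, since subprograms
    run on top of new frames. *)
Lemma machine_complete x p args v K :
  eval x p args v -> reaches x (st_eval (code p) (enc args) K) (st_ret v K).
Proof.
  intros H. revert K. revert p args v H.
  apply (eval_mut x
    (fun p args v => forall K, reaches x (st_eval (code p) (enc args) K) (st_ret v K))
    (fun gs args ys => forall K, reaches x (st_list (codes gs) (enc args) K) (st_ret (enc ys) K))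
    (fun f args m n => forall K,
       reaches x (st_eval (code f) (enc (m :: args)) (push 4 (npair (code f) (npair (enc args) m)) K))
         (st_ret n K))).
  - intros. machine_step. apply reaches_refl.
  - intros. machine_step. rewrite lhd_enc. apply reaches_refl.
  - intros. machine_step. rewrite lnth_enc. apply reaches_refl.
  - intros. machine_step. rewrite lhd_enc. apply reaches_refl.
  - intros f gs args ys v _ IHgs _ IHf K. machine_step.
    eapply reaches_trans; [apply IHgs|]. machine_step. apply IHf.
  - intros f g rest v _ IH K. machine_step. apply IH.
  - intros f g n rest y v _ IHr _ IHg K. machine_step. cbn [pred].
    eapply reaches_trans; [apply (IHr (push _ _ _))|]. machine_step. apply IHg.
  - intros f args n _ IH K. machine_step. apply IH.
  - intros. machine_step. apply reaches_refl.
  - intros g gs args y ys _ IHg _ IHgs K. machine_step.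
    (* The code of a nonempty list is a successor, which decides the test in [step_list]. *)
    unfold lcons at 1. cbn [Nat.eqb].
    eapply reaches_trans; [apply IHg|]. machine_step.
    eapply reaches_trans; [apply IHgs|]. machine_step. apply reaches_refl.
  - intros f args m _ IH K. eapply reaches_trans; [apply IH|]. machine_step. apply reaches_refl.
  - intros f args m k n _ IHf _ IHm K. eapply reaches_trans; [apply IHf|]. machine_step. apply IHm.
Qed.

(* [0] means that the run has not halted by time [t]; [S v], that it returned [v]. *)
Definition U (x : real) (e n t : nat) : nat :=
  let c := run x t (st_eval e (lcons n 0) 0) in
  if c =? st_ret (pfst (psnd c)) 0 then S (pfst (psnd c)) else 0.

Lemma U_complete x p n v : eval x p [n] v -> exists t, U x (code p) n t = S v.
Proof.
  intros H. destruct (machine_complete x p [n] v 0 H) as [t Ht]. exists t.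
  unfold U. change (lcons n 0) with (enc [n]). rewrite Ht.
  assert (E : pfst (psnd (st_ret v 0)) = v) by (unfold st_ret; rewrite psnd_pair; apply pfst_pair).
  cbv zeta. rewrite E, Nat.eqb_refl. reflexivity.
Qed.

(** The longer run continues the shorter one, which has already reached a fixed point. With
    [U_complete], every halting run of a program that evaluates to [v] returns [v]. *)
Lemma U_functional x e n s t v w : U x e n s = S v -> U x e n t = S w -> v = w.
Proof.
  unfold U. set (c0 := st_eval e (lcons n 0) 0).
  assert (Hret : forall v w, st_ret v 0 = st_ret w 0 -> v = w).
  { intros v' w' H. apply (f_equal (fun c => pfst (psnd c))) in H. unfold st_ret in H.
    rewrite !psnd_pair, !pfst_pair in H. exact H. }
  assert (Hhalt : forall d v, run x d (st_ret v 0) = st_ret v 0).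
  { intros d v'; induction d as [|d IH]; [reflexivity|].
    transitivity (step x (st_ret v' 0)); [exact (f_equal (step x) IH) | apply step_halted]. }
  destruct (Nat.eqb_spec (run x s c0) (st_ret (pfst (psnd (run x s c0))) 0)) as [Es|]; [|discriminate].
  destruct (Nat.eqb_spec (run x t c0) (st_ret (pfst (psnd (run x t c0))) 0)) as [Et|]; [|discriminate].
  intros Hv Hw. injection Hv as Hv. injection Hw as Hw. rewrite Hv in Es. rewrite Hw in Et.
  destruct (Nat.le_ge_cases s t) as [Hl|Hl].
  - apply Hret. rewrite <- Et. replace t with (t - s + s) by lia.
    rewrite run_add, Es, Hhalt. reflexivity.
  - apply Hret. rewrite <- Es. replace s with (s - t + t) by lia.
    rewrite run_add, Et, Hhalt. reflexivity.
Qed.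

Lemma computable_lnth X k F G :
  computable X k F -> computable X k G -> computable X k (fun a => lnth (F a) (G a)).
Proof.
  apply (computable_comp2 X k lnth). apply computable_pfst, computable_pred.
  apply (computable_rec X 2 _ _ (fun _ y _ => ltl y)); unfold ltl; comp.
Qed.
#[local] Hint Resolve computable_lnth : comp.

Lemma computable_real X k x F :
  turing_le x X -> computable X k F -> computable X k (fun a => b2n (x (F a))).
Proof.
  intros [p Hp]. apply (computable_comp1 X k (fun n => b2n (x n))).
  exists p. intros [|n [|]] Ha; try discriminate. apply Hp.
Qed.
#[local] Hint Resolve computable_real : comp.

Lemma computable_step X k x F :
  turing_le x X -> computable X k F -> computable X k (fun a => step x (F a)).
Proof.
  intros Hx. apply (computable_comp1 X k (step x)).
  unfold step, step_eval, step_list, step_frame, push, st_eval, st_ret, st_list, lhd, ltl, lcons.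
  comp.
Qed.
#[local] Hint Resolve computable_step : comp.

Lemma computable_U X k x E N T :
  turing_le x X -> computable X k E -> computable X k N -> computable X k T ->
  computable X k (fun a => U x (E a) (N a) (T a)).
Proof.
  intros Hx. apply (computable_comp3 X k (U x)).
  assert (H : forall k E N T, computable X k E -> computable X k N -> computable X k T ->
    computable X k (fun a => run x (T a) (st_eval (E a) (lcons (N a) 0) 0))).
  { clear - Hx. intros k E N T HE HN HT. unfold run.
    apply (computable_rec X k T _ (fun _ y _ => step x y)); [exact HT | unfold st_eval, lcons; comp | comp]. }
  unfold U, st_ret. cbv zeta. comp.
Qed.
#[local] Hint Resolve computable_U : comp.

(** * Turing reducibility *)

Lemma turing_le_computable y X :
  turing_le y X <-> computable X 1 (fun a => b2n (y (nth 0 a 0))).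
Proof.
  split; intros [p Hp]; exists p.
  - intros [|n [|]] Ha; try discriminate. apply Hp.
  - intros n. apply (Hp [n]). reflexivity.
Qed.

Lemma turing_le_refl x : turing_le x x.
Proof. exists POracle. intros n. apply (ev_oracle x [n]). Qed.

Lemma least_nat (P : nat -> Prop) : (exists n, P n) -> exists n, P n /\ forall i, i < n -> ~ P i.
Proof.
  intros [n Hn]. revert n Hn. induction n as [n IH] using (well_founded_induction lt_wf).
  intros Hn. destruct (classic (exists i, i < n /\ P i)) as [(i & Hi & H)|H].
  - exact (IH i Hi H).
  - exists n. split; [exact Hn|]. intros i Hi Pi. apply H. eauto.
Qed.

(** The machine with oracle [b] can be simulated from [c]; the value of [a] at [n] is read off at
    the least halting time, which an unbounded search finds. *)
Lemma turing_le_trans a b c : turing_le a b -> turing_le b c -> turing_le a c.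
Proof.
  intros [p Hp] Hbc.
  assert (Hm : forall n, exists t, U b (code p) n t <> 0 /\ forall i, i < t -> ~ U b (code p) n i <> 0).
  { intros n. apply least_nat. destruct (U_complete b p n _ (Hp n)) as [t Ht].
    exists t. rewrite Ht. discriminate. }
  set (m := fun n => proj1_sig (constructive_indefinite_description _ (Hm n))).
  assert (Hm' : forall n, U b (code p) n (m n) <> 0 /\ forall i, i < m n -> ~ U b (code p) n i <> 0).
  { intros n. exact (proj2_sig (constructive_indefinite_description _ (Hm n))). }
  clearbody m. apply turing_le_computable.
  apply computable_ext with (F := fun l => pred (U b (code p) (nth 0 l 0) (m (nth 0 l 0)))).
  - intros l _. set (n := nth 0 l 0). destruct (Hm' n) as [H _].
    destruct (U_complete b p n _ (Hp n)) as [t Ht].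
    destruct (U b (code p) n (m n)) as [|v] eqn:E; [congruence|].
    exact (U_functional _ _ _ _ _ _ _ E Ht).
  - assert (computable c 1 (fun l => m (nth 0 l 0))).
    { apply computable_least with
        (F := fun i l => b2n (U b (code p) (nth 0 l 0) i =? 0)); [comp|].
      intros l _. destruct (Hm' (nth 0 l 0)) as [H1 H2]. split.
      - apply Nat.eqb_neq in H1. rewrite H1. reflexivity.
      - intros i Hi H3. apply (H2 i Hi). intros H4. rewrite H4 in H3. discriminate. }
    comp.
Qed.

Lemma turing_incomplete x : exists y, ~ turing_le y x.
Proof.
  (* Diagonalization: the number [2] is [S (b2n true)], so [y n] differs from any bit that index [n]
     outputs on [n]. *)
  set (y := fun n : nat =>
    if excluded_middle_informative (exists t, U x n n t = 2) then false else true).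
  exists y. intros [p Hp]. destruct (U_complete x p (code p) _ (Hp _)) as [t Ht].
  unfold y in Ht. destruct (excluded_middle_informative _) as [[s Hs]|H].
  - pose proof (U_functional _ _ _ _ _ _ _ Hs Ht). discriminate.
  - apply H. exists t. exact Ht.
Qed.

(** A member sits in the join along a position map [h], built from doublings and successors. The map
    is computable from every oracle, so the induction may change the join. *)
Lemma turing_le_joinl a a0 l : In a (a0 :: l) -> turing_le a (joinl a0 l).
Proof.
  intros H.
  assert (H' : exists h, (forall X, computable X 1 (fun s => h (nth 0 s 0))) /\
                         forall r, joinl a0 l (h r) = a r).
  { revert a0 H. induction l as [|a1 l IH]; intros a0 H.
    - destruct H as [<-|[]]. exists (fun r => r). split; [intros; comp | reflexivity].
    - destruct H as [<-|H].
      + exists (fun r => r + r). split; [intros; comp|]. intros r. cbn. unfold join.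
        replace (r + r) with (2 * r) by lia.
        rewrite Nat.even_mul, Nat.div2_double. reflexivity.
      + destruct (IH a1 H) as (h & Hh & E). exists (fun r => S (h r + h r)). split.
        * intros X. specialize (Hh X). comp.
        * intros r. rewrite <- E. cbn [joinl]. unfold join.
          replace (h r + h r) with (2 * h r) by lia.
          rewrite Nat.even_succ, <- Nat.negb_even, Nat.even_mul, Nat.div2_succ_double. reflexivity. }
  destruct H' as (h & Hh & E). apply turing_le_computable.
  apply computable_ext with (F := fun s => b2n (joinl a0 l (h (nth 0 s 0)))).
  - intros s _. rewrite E. reflexivity.
  - apply computable_real; [apply turing_le_refl | apply Hh].
Qed.

(** * Identifying indices and departures *)

Definition names (x : real) (e : nat) (b : real) : Prop :=
  forall r, exists t, U x e r t = S (b2n (b r)).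

Definition confirms (x c : real) (e M N : nat) : bool :=
  ball M (fun r => bex N (fun t => U x e r t =? S (b2n (c r)))).

Definition least_confirmed (x c : real) (e M N : nat) : bool :=
  confirms x c e M N && ball e (fun e' => negb (confirms x c e' M N)).

Definition departs (x c : real) (e k N : nat) : bool :=
  confirms x c e k N && bex N (fun t => U x e k t =? S (b2n (negb (c k)))).

(** For given bounds at most one index is least confirmed, so the search with these bounds ends at a
    true index of [b]. *)
Definition identified (x b : real) (M N : nat) : Prop :=
  exists e, names x e b /\ least_confirmed x b e M N = true.

Lemma confirms_spec x c e M N :
  confirms x c e M N = true <->
  forall r, r < M -> exists t, t < N /\ U x e r t = S (b2n (c r)).
Proof.
  unfold confirms. rewrite ball_spec. split; intros H r Hr; specialize (H r Hr).
  - apply bex_spec in H as (t & Ht & H). apply Nat.eqb_eq in H. eauto.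
  - apply bex_spec. destruct H as (t & Ht & H). exists t. rewrite Nat.eqb_eq. auto.
Qed.

Lemma confirms_ext x b c e M N : agree_upto M b c -> confirms x b e M N = confirms x c e M N.
Proof.
  intros H. apply eq_true_iff_eq. rewrite !confirms_spec.
  split; intros H' r Hr; destruct (H' r Hr) as (t & Ht & E); exists t;
    rewrite E, H by exact Hr; auto.
Qed.

Lemma b2n_inj a b : b2n a = b2n b -> a = b.
Proof. destruct a, b; discriminate || reflexivity. Qed.

Lemma choose_bound (P : nat -> nat -> Prop) n :
  (forall r s s', s <= s' -> P r s -> P r s') ->
  (forall r, r < n -> exists s, P r s) -> exists s, forall r, r < n -> P r s.
Proof.
  intros Hmon. induction n as [|n IH]; intros H.
  - exists 0. lia.
  - destruct IH as [s Hs]; [intros; apply H; lia|].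
    destruct (H n) as [s' Hs']; [lia|]. exists (s + s'). intros r Hr.
    destruct (Nat.eq_dec r n) as [->|]; [apply (Hmon n s') | apply (Hmon r s)]; auto; try lia.
    apply Hs; lia.
Qed.

Lemma names_confirms x e b M :
  names x e b -> exists N0, forall N, N0 <= N -> confirms x b e M N = true.
Proof.
  intros H.
  destruct (choose_bound (fun r N => exists t, t < N /\ U x e r t = S (b2n (b r))) M) as [N0 HN].
  - intros r s s' Hs (t & Ht & E). exists t. split; [lia|exact E].
  - intros r _. destruct (H r) as [t Ht]. exists (S t), t. auto.
  - exists N0. intros N HN'. apply confirms_spec. intros r Hr.
    destruct (HN r Hr) as (t & Ht & E). exists t. split; [lia|exact E].
Qed.

(* Every index below the least correct one fails at some argument below [M0],
   and no running time can make it pass. *)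
Lemma identify x b :
  turing_le b x ->
  exists M0, forall M, M0 <= M -> exists N0, forall N, N0 <= N -> identified x b M N.
Proof.
  intros [p Hp]. destruct (least_nat (fun e => names x e b)) as (e & He & Hleast).
  { exists (code p). intros r. apply U_complete, Hp. }
  destruct (choose_bound
    (fun e' M => exists r, r < M /\ forall t, U x e' r t <> S (b2n (b r))) e) as [M0 HM].
  - intros e' s s' Hs (r & Hr & H). exists r. split; [lia|exact H].
  - intros e' He'. apply Hleast in He'. apply not_all_ex_not in He' as [r Hr].
    exists (S r), r. split; [lia|]. apply not_ex_all_not, Hr.
  - exists M0. intros M HM'. destruct (names_confirms x e b M He) as [N0 HN].
    exists N0. intros N HN'. exists e. split; [exact He|].
    unfold least_confirmed. rewrite HN by exact HN'. apply ball_spec. intros e' He'.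
    apply negb_true_iff, not_true_iff_false. rewrite confirms_spec. intros H.
    destruct (HM e' He') as (r & Hr & Hne). destruct (H r) as (t & _ & E); [lia|].
    exact (Hne t E).
Qed.

(** The tests read only values below [M], where [b] and [c] agree. Hence both have the same least
    confirmed index, and for [b] it is correct. *)
Lemma least_confirmed_names x b c e M N :
  identified x b M N -> agree_upto M b c -> least_confirmed x c e M N = true -> names x e b.
Proof.
  intros (e0 & He0 & H0) Hag H. unfold least_confirmed in *.
  apply andb_true_iff in H0 as [H0 H0']. apply andb_true_iff in H as [H H'].
  rewrite <- (confirms_ext x b c) in H by exact Hag. rewrite ball_spec in *.
  destruct (lt_eq_lt_dec e e0) as [[L|<-]|L]; [|exact He0|].
  - apply H0' in L. rewrite H in L. discriminate.
  - apply H' in L. rewrite <- (confirms_ext x b c), H0 in L by exact Hag. discriminate.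
Qed.

Lemma identified_confirmed x b c M N :
  identified x b M N -> agree_upto M b c -> exists e, least_confirmed x c e M N = true.
Proof.
  intros (e & _ & H) Hag. exists e. unfold least_confirmed in *.
  apply andb_true_iff in H as [H H']. rewrite <- (confirms_ext x b c), H by exact Hag.
  apply ball_spec. rewrite ball_spec in H'. intros e' He'. rewrite <- (confirms_ext x b c) by exact Hag. auto.
Qed.

(** A departure announced before [k] would contradict agreement there; one announced after [k] would
    require [e] to reproduce the value of [c] at [k], where [b] differs. *)
Lemma departs_unique x b c e k j N :
  names x e b -> agree_upto k b c -> c k <> b k -> departs x c e j N = true -> j = k.
Proof.
  intros He Hag Hk H. unfold departs in H. apply andb_true_iff in H as [H1 H2].
  rewrite confirms_spec in H1. apply bex_spec in H2 as (t & _ & H2). apply Nat.eqb_eq in H2.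
  destruct (lt_eq_lt_dec j k) as [[L| ->]|L]; [|reflexivity|].
  - destruct (He j) as [s Hs]. pose proof (U_functional _ _ _ _ _ _ _ Hs H2) as E.
    apply b2n_inj in E. rewrite (Hag j L) in E. destruct (c j); discriminate.
  - destruct (H1 k L) as (s & _ & Hs). destruct (He k) as [s' Hs'].
    pose proof (U_functional _ _ _ _ _ _ _ Hs Hs') as E. apply b2n_inj in E. contradiction.
Qed.

Lemma departs_eventually x b c e k :
  names x e b -> agree_upto k b c -> c k <> b k ->
  exists N0, forall N, N0 <= N -> departs x c e k N = true.
Proof.
  intros He Hag Hk. destruct (names_confirms x e b k He) as [N0 HN].
  destruct (He k) as [t Ht]. exists (N0 + S t). intros N HN'. unfold departs.
  rewrite <- (confirms_ext x b c), HN by (exact Hag || lia). apply bex_spec.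
  exists t. split; [lia|]. apply Nat.eqb_eq. rewrite Ht.
  destruct (b k) eqn:?, (c k) eqn:?; cbn; congruence.
Qed.

(** * The decoder *)

(** The step relation is first made total outside [V], so that choice yields a function on all pairs
    [n], [t]. *)
Lemma dependent_choice {T} (V : T -> Prop) (R : nat -> T -> T -> Prop) (t0 : T) :
  V t0 -> (forall n t, V t -> exists t', V t' /\ R n t t') ->
  exists f, f 0 = t0 /\ forall n, V (f n) /\ R n (f n) (f (S n)).
Proof.
  intros H0 H.
  assert (H' : forall n t, exists t', V t -> V t' /\ R n t t').
  { intros n t. destruct (classic (V t)) as [Ht|Ht].
    - destruct (H n t Ht) as [t' Ht']. eauto.
    - exists t. tauto. }
  set (g := fun n t => proj1_sig (constructive_indefinite_description _ (H' n t))).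
  assert (Hg : forall n t, V t -> V (g n t) /\ R n t (g n t)).
  { intros n t. exact (proj2_sig (constructive_indefinite_description _ (H' n t))). }
  set (f := nat_rect (fun _ => T) t0 g).
  assert (Hf : forall n, V (f n)) by (induction n; [exact H0 | apply Hg; assumption]).
  exists f. split; [reflexivity|]. intros n. split; [apply Hf | apply (Hg n (f n)), Hf].
Qed.

(** The search has to succeed only along the sequence itself. So [PMin] is placed directly under
    [PRec], whereas [computable_rec] asks for a total step function. *)
Lemma computable_search_sequence X (T : nat -> nat -> nat -> bool) (s : nat -> nat) :
  computable X 3 (fun a => b2n (T (nth 0 a 0) (nth 1 a 0) (nth 2 a 0))) ->
  (forall n, T (s (S n)) n (s n) = true /\ forall w, w < s (S n) -> T w n (s n) <> true) ->
  computable X 1 (fun a => s (nth 0 a 0)).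
Proof.
  intros HT Hs. apply computable_negb in HT as [p Hp].
  destruct (computable_const X 0 (s 0)) as [q Hq].
  exists (PRec q (PMin p)). intros [|n [|]] Ha; try discriminate. cbn [nth].
  induction n as [|n IH].
  - constructor. apply Hq. reflexivity.
  - econstructor; [apply IH; reflexivity|]. constructor.
    destruct (Hs n) as [H1 H2].
    apply msearch_least with (f := fun w => b2n (negb (T w n (s n)))).
    + intros w _. apply (Hp [w; n; s n]). reflexivity.
    + rewrite H1. reflexivity.
    + intros w Hw. apply H2 in Hw. destruct (T w n (s n)); [congruence | discriminate].
Qed.

(* Decoder states have the form (departures, (indices, search bound)). *)
Definition dep1 (w : nat) : nat := pfst (pfst w).
Definition dep2 (w : nat) : nat := psnd (pfst w).
Definition ind1 (w : nat) : nat := pfst (pfst (psnd w)).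
Definition ind2 (w : nat) : nat := psnd (pfst (psnd w)).
Definition fuel (w : nat) : nat := psnd (psnd w).
Definition mkstate (k1 k2 e1 e2 t : nat) : nat := npair (npair k1 k2) (npair (npair e1 e2) t).

(** One number [w] bundles departures, new indices and running time, so a single unbounded search
    performs a whole stage. *)
Definition next_state (x : real) (D1 D2 : nat -> real) (w n s : nat) : bool :=
  departs x (D1 n) (ind1 s) (dep1 w) (fuel w) &&
  departs x (D2 n) (ind2 s) (dep2 w) (fuel w) &&
  least_confirmed x (D1 (S n)) (ind1 w) (Nat.min (dep1 w) (dep2 w)) (Nat.max (dep1 w) (dep2 w)) &&
  least_confirmed x (D2 (S n)) (ind2 w) (Nat.min (dep1 w) (dep2 w)) (Nat.max (dep1 w) (dep2 w)).

(** The form with composed arguments lets a hypothesis of this kind act as a closure rule for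
    [comp]. *)
Definition uniformly_le (D : nat -> real) (X : real) : Prop :=
  forall k F G, computable X k F -> computable X k G -> computable X k (fun a => b2n (D (F a) (G a))).

Lemma computable_next_state X x D1 D2 :
  turing_le x X -> uniformly_le D1 X -> uniformly_le D2 X ->
  computable X 3 (fun a => b2n (next_state x D1 D2 (nth 0 a 0) (nth 1 a 0) (nth 2 a 0))).
Proof.
  intros Hx HD1 HD2. unfold uniformly_le in *.
  unfold next_state, departs, least_confirmed, confirms, dep1, dep2, ind1, ind2, fuel.
  comp.
Qed.

(** The invariant is [good]: the state holds true indices of the reals followed at stage [n]. These
    determine the departures, whose order is the bit and whose sizes identify the next pair. *)
Lemma decode X x y (D1 D2 a1 a2 : nat -> real) (k1 k2 : nat -> nat) :
  turing_le x X -> uniformly_le D1 X -> uniformly_le D2 X ->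
  turing_le (a1 0) x -> turing_le (a2 0) x ->
  (forall n, agree_upto (k1 n) (a1 n) (D1 n) /\ D1 n (k1 n) <> a1 n (k1 n)) ->
  (forall n, agree_upto (k2 n) (a2 n) (D2 n) /\ D2 n (k2 n) <> a2 n (k2 n)) ->
  (forall n, identified x (a1 (S n)) (Nat.min (k1 n) (k2 n)) (Nat.max (k1 n) (k2 n)) /\
             identified x (a2 (S n)) (Nat.min (k1 n) (k2 n)) (Nat.max (k1 n) (k2 n))) ->
  (forall n, k1 n < k1 (S n)) -> (forall n, k2 n < k2 (S n)) ->
  (forall n, (k1 n <? k2 n) = y n) ->
  turing_le y X.
Proof.
  intros Hx HD1 HD2 [p1 Hp1] [p2 Hp2] H1 H2 Hid Hk1 Hk2 Hy.
  set (good := fun n s => names x (ind1 s) (a1 n) /\ names x (ind2 s) (a2 n)).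
  assert (Hag1 : forall n, agree_upto (Nat.min (k1 n) (k2 n)) (a1 (S n)) (D1 (S n))).
  { intros n r Hr. apply H1. specialize (Hk1 n). lia. }
  assert (Hag2 : forall n, agree_upto (Nat.min (k1 n) (k2 n)) (a2 (S n)) (D2 (S n))).
  { intros n r Hr. apply H2. specialize (Hk2 n). lia. }
  assert (Hsound : forall n s w, good n s -> next_state x D1 D2 w n s = true ->
            dep1 w = k1 n /\ dep2 w = k2 n /\ good (S n) w).
  { intros n s w [G1 G2] H. unfold next_state in H. rewrite !andb_true_iff in H.
    destruct H as [[[E1 E2] E3] E4].
    destruct (H1 n) as [A1 B1]. destruct (H2 n) as [A2 B2]. destruct (Hid n) as [I1 I2].
    pose proof (departs_unique _ _ _ _ _ _ _ G1 A1 B1 E1) as F1.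
    pose proof (departs_unique _ _ _ _ _ _ _ G2 A2 B2 E2) as F2.
    rewrite F1, F2 in *. do 3 (split; [auto|]).
    - exact (least_confirmed_names _ _ _ _ _ _ I1 (Hag1 n) E3).
    - exact (least_confirmed_names _ _ _ _ _ _ I2 (Hag2 n) E4). }
  assert (Hex : forall n s, good n s -> exists w, next_state x D1 D2 w n s = true).
  { intros n s [G1 G2].
    destruct (H1 n) as [A1 B1]. destruct (H2 n) as [A2 B2]. destruct (Hid n) as [I1 I2].
    destruct (departs_eventually _ _ _ _ _ G1 A1 B1) as [t1 Ht1].
    destruct (departs_eventually _ _ _ _ _ G2 A2 B2) as [t2 Ht2].
    destruct (identified_confirmed _ _ _ _ _ I1 (Hag1 n)) as [e1 He1].
    destruct (identified_confirmed _ _ _ _ _ I2 (Hag2 n)) as [e2 He2].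
    exists (mkstate (k1 n) (k2 n) e1 e2 (t1 + t2)).
    unfold next_state, dep1, dep2, ind1 at 2, ind2 at 2, fuel, mkstate.
    repeat rewrite ?pfst_pair, ?psnd_pair.
    rewrite Ht1, Ht2, He1, He2 by lia. reflexivity. }
  (* The stage number is carried along with the state because [good] depends on it. The initial
     indices are the codes of the given programs; zeros fill the other fields. *)
  destruct (dependent_choice (fun ns : nat * nat => good (fst ns) (snd ns))
    (fun _ ns nw => fst nw = S (fst ns) /\
       next_state x D1 D2 (snd nw) (fst ns) (snd ns) = true /\
       forall w, w < snd nw -> next_state x D1 D2 w (fst ns) (snd ns) <> true)
    (0, mkstate 0 0 (code p1) (code p2) 0)) as (f & Hf0 & Hf).
  { unfold good, ind1, ind2, mkstate; cbn [fst snd]. repeat rewrite ?pfst_pair, ?psnd_pair.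
    split; intros r; apply U_complete; auto. }
  { intros _ [n s] Hns. cbn [fst snd] in *.
    destruct (least_nat (fun w => next_state x D1 D2 w n s = true) (Hex n s Hns)) as (w & Hw & Hl).
    exists (S n, w). cbn [fst snd]. repeat split; auto; apply (Hsound n s w Hns Hw). }
  set (s := fun n => snd (f n)).
  assert (Hfst : forall n, fst (f n) = n).
  { induction n as [|n IH]; [rewrite Hf0; reflexivity|].
    destruct (Hf n) as (_ & E & _). rewrite E, IH. reflexivity. }
  assert (Hgood : forall n, good n (s n)).
  { intros n. destruct (Hf n) as [G _]. rewrite Hfst in G. exact G. }
  assert (Hstep : forall n, next_state x D1 D2 (s (S n)) n (s n) = true /\
            forall w, w < s (S n) -> next_state x D1 D2 w n (s n) <> true).
  { intros n. destruct (Hf n) as (_ & _ & H). rewrite Hfst in H. exact H. }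
  assert (Hs : computable X 1 (fun a => s (nth 0 a 0))).
  { apply (computable_search_sequence X (next_state x D1 D2)); [|exact Hstep].
    apply computable_next_state; assumption. }
  apply turing_le_computable.
  (* State [S n] records the departures of stage [n]. *)
  apply computable_ext with
    (F := fun a => b2n (dep1 (s (S (nth 0 a 0))) <? dep2 (s (S (nth 0 a 0))))).
  - intros a _. set (n := nth 0 a 0).
    destruct (Hsound n (s n) (s (S n)) (Hgood n) (proj1 (Hstep n))) as (-> & -> & _).
    rewrite Hy. reflexivity.
  - assert (HsS : computable X 1 (fun a => s (S (nth 0 a 0)))).
    { apply (computable_comp1 X 1 s (fun a => S (nth 0 a 0))); [exact Hs | comp]. }
    unfold dep1, dep2. comp.
Qed.

(** * Coding a real into four elements of a perfect set *)

(** Terms of equal parity agree on growing prefixes and converge within the closed set. Later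
    changes occur beyond position [k n], so the limit inherits the departure of [a (S (S n))] from
    [a n]. *)
Lemma alternating_limits (P : rset) (a : nat -> real) (k : nat -> nat) :
  closed_set P -> (forall n, P (a n)) -> (forall n, k n < k (S n)) ->
  (forall n, agree_upto (k n) (a n) (a (S (S n))) /\ a (S (S n)) (k n) <> a n (k n)) ->
  exists c0 c1, P c0 /\ P c1 /\
    forall n, agree_upto (k n) (a n) (if Nat.even n then c0 else c1) /\
              (if Nat.even n then c0 else c1) (k n) <> a n (k n).
Proof.
  intros Hcl HP Hk Ha.
  assert (Hkn : forall n, n <= k n).
  { induction n as [|n IH]; [lia|]. specialize (Hk n). lia. }
  assert (Hmon : forall d n, k n <= k (n + d)).
  { intros d n; induction d as [|d IH]; [rewrite Nat.add_0_r; lia|].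
    rewrite Nat.add_succ_r. specialize (Hk (n + d)). lia. }
  assert (Hag : forall d n, agree_upto (k n) (a n) (a (n + 2 * d))).
  { induction d as [|d IH]; intros n r Hr.
    - rewrite Nat.add_0_r. reflexivity.
    - rewrite (IH n r Hr). replace (n + 2 * S d) with (S (S (n + 2 * d))) by lia.
      apply Ha. specialize (Hmon (2 * d) n). lia. }
  assert (Hlim : forall i, exists c, P c /\ forall m, agree_upto (k (i + 2 * m)) (a (i + 2 * m)) c).
  { intros i. set (c := fun r => a (i + 2 * S r) r).
    assert (Hc : forall m, agree_upto (k (i + 2 * m)) (a (i + 2 * m)) c).
    { intros m r Hr. unfold c. destruct (Nat.le_ge_cases m (S r)) as [L|L].
      - replace (i + 2 * S r) with (i + 2 * m + 2 * (S r - m)) by lia. apply Hag, Hr.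
      - replace (i + 2 * m) with (i + 2 * S r + 2 * (m - S r)) by lia. symmetry. apply Hag.
        specialize (Hkn (i + 2 * S r)). lia. }
    exists c. split; [|exact Hc]. apply Hcl. intros n. exists (a (i + 2 * n)). split; [apply HP|].
    intros r Hr. symmetry. apply Hc. specialize (Hkn (i + 2 * n)). lia. }
  destruct (Hlim 0) as (c0 & P0 & L0). destruct (Hlim 1) as (c1 & P1 & L1).
  exists c0, c1. do 2 (split; [assumption|]).
  assert (H : forall n, agree_upto (k n) (a n) (if Nat.even n then c0 else c1)).
  { intros n. destruct (Nat.even n) eqn:E.
    - apply Nat.even_spec in E as [m ->]. apply L0.
    - rewrite <- Nat.negb_odd in E. apply negb_false_iff, Nat.odd_spec in E as [m ->].
      rewrite (Nat.add_comm (2 * m) 1). apply L1. }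
  intros n. split; [apply H|]. pose proof (H (S (S n)) (k n)) as E.
  change (Nat.even (S (S n))) with (Nat.even n) in E. rewrite <- E.
  - apply Ha.
  - pose proof (Hk n). pose proof (Hk (S n)). lia.
Qed.

Lemma real_neq_least (a b : real) :
  a <> b -> exists k, agree_upto k a b /\ b k <> a k.
Proof.
  intros H. destruct (least_nat (fun k => b k <> a k)) as (k & Hk & Hl).
  - apply not_all_ex_not. intros E. apply H, functional_extensionality. auto.
  - exists k. split; [|exact Hk]. intros i Hi. apply Hl, NNPP in Hi. auto.
Qed.

Lemma uniformly_le_alternating X c0 c1 :
  turing_le c0 X -> turing_le c1 X -> uniformly_le (fun n => if Nat.even n then c0 else c1) X.
Proof.
  intros H0 H1 k F G HF HG.
  apply computable_ext with
    (F := fun a => if nat_rec (fun _ => nat) 1 (fun _ y => 1 - y) (F a) =? 1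
                   then b2n (c0 (G a)) else b2n (c1 (G a))).
  - intros a _.
    assert (E : nat_rec (fun _ => nat) 1 (fun _ y => 1 - y) (F a) = b2n (Nat.even (F a))).
    { induction (F a) as [|n IH]; [reflexivity|]. rewrite Nat.even_succ, <- Nat.negb_even.
      cbn [nat_rec nat_rect]. fold (nat_rec (fun _ => nat)). unfold nat_rec in IH |- *. rewrite IH.
      destruct (Nat.even n); reflexivity. }
    rewrite E. destruct (Nat.even (F a)); reflexivity.
  - assert (computable X k (fun a => nat_rec (fun _ => nat) 1 (fun _ y => 1 - y) (F a))).
    { apply (computable_rec X k F (fun _ => 1) (fun _ y _ => 1 - y)); comp. }
    comp.
Qed.

(* The active pair of reals follows [act1], [act2], whose indices the decoder knows;
   the other pair already follows [wait1], [wait2], whose indices it will learn from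
   the departures of the active pair. [left1], [left2] are the previous departures. *)
Record conf := Conf {
  act1 : real; act2 : real; wait1 : real; wait2 : real;
  left1 : nat; left2 : nat; low : nat }.

(** The cylinder given by [z] and [m] serves to keep the four reals away from a prescribed real. *)
Theorem perfect_coding (P : rset) (x y z : real) (m : nat) :
  perfect_set P -> dense_in (fun b => P b /\ turing_le b x) P -> P z ->
  exists c0 c1 c2 c3,
    (forall c, In c [c0; c1; c2; c3] -> P c /\ agree_upto m z c) /\
    forall X, turing_le x X -> (forall c, In c [c0; c1; c2; c3] -> turing_le c X) -> turing_le y X.
Proof.
  intros (_ & Hcl & Hperf) [_ Hdense] Hz.
  set (Q := fun b => P b /\ turing_le b x) in *.
  set (leaves := fun (a : real) (k : nat) (b : real) => agree_upto k a b /\ b k <> a k).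
  assert (Hdep : forall a l, Q a -> exists k b, l <= k /\ Q b /\ leaves a k b).
  { intros a l [Ha _]. destruct (Hperf a Ha l) as (d & Hd & Hne & Hag).
    destruct (real_neq_least a d) as (k & Hk & Hk'); [congruence|].
    (* Agreement through position [k] itself lets the [x]-computable [b] inherit the departure of
       [d]. *)
    destruct (Hdense d Hd (S k)) as (b & Hb & Hb'). exists k, b.
    repeat split; try apply Hb.
    - destruct (Nat.le_gt_cases l k) as [L|L]; [exact L|]. apply Hag in L. congruence.
    - intros i Hi. rewrite Hk by exact Hi. apply Hb'. lia.
    - rewrite <- Hb' by lia. exact Hk'. }
  assert (Hpair : forall a a' d d' l, Q a -> Q a' -> Q d -> Q d' ->
    exists k k' b b', l <= k /\ k < k' /\ Q b /\ Q b' /\ leaves a k b /\ leaves a' k' b' /\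
      identified x d k k' /\ identified x d' k k').
  { intros a a' d d' l Ha Ha' [_ Hd] [_ Hd'].
    destruct (identify x d Hd) as [M HM]. destruct (identify x d' Hd') as [M' HM'].
    (* The first departure [k] is large enough to serve as prefix length for [d] and [d']; the time
       bounds depend on [k], and [k'] is then taken beyond them. *)
    destruct (Hdep a (l + M + M') Ha) as (k & b & Hk & Hb & Hl).
    destruct (HM k) as [N HN]; [lia|]. destruct (HM' k) as [N' HN']; [lia|].
    destruct (Hdep a' (S k + N + N') Ha') as (k' & b' & Hk' & Hb' & Hl').
    exists k, k', b, b'. repeat split; try apply Hb; try apply Hb'; try apply Hl; try apply Hl'; try lia.
    - apply HN; lia.
    - apply HN'; lia. }
  destruct (Hdense z Hz m) as (b0 & Hb0 & Hzb0).
  (* All four reals start at [b0]; [low] starts at [m], so no departure occurs inside the prefix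
     shared with [z]. *)
  destruct (dependent_choice
    (fun c => Q (act1 c) /\ Q (act2 c) /\ Q (wait1 c) /\ Q (wait2 c))
    (fun n c c' =>
       act1 c' = wait1 c /\ act2 c' = wait2 c /\
       leaves (act1 c) (left1 c') (wait1 c') /\ leaves (act2 c) (left2 c') (wait2 c') /\
       low c <= left1 c' < low c' /\ low c <= left2 c' < low c' /\
       (left1 c' <? left2 c') = y n /\
       identified x (wait1 c) (Nat.min (left1 c') (left2 c')) (Nat.max (left1 c') (left2 c')) /\
       identified x (wait2 c) (Nat.min (left1 c') (left2 c')) (Nat.max (left1 c') (left2 c')))
    (Conf b0 b0 b0 b0 0 0 m)) as (f & Hf0 & Hf).
  { cbn. auto. }
  { intros n [a a' d d' i1 i2 l] (Ha & Ha' & Hd & Hd'). cbn [act1 act2 wait1 wait2 left1 left2 low] in *.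
    (* [Hpair] makes its first argument depart first, so the order of its arguments encodes the
       bit. *)
    destruct (y n).
    - destruct (Hpair a a' d d' l) as (k & k' & b & b' & H1 & H2 & H3 & H4 & H5 & H6 & H7 & H8); auto.
      exists (Conf d d' b b' k k' (S k')). cbn [act1 act2 wait1 wait2 left1 left2 low].
      rewrite Nat.min_l, Nat.max_r, Nat.ltb_lt by lia.
      repeat split; auto; lia || apply H3 || apply H4 || apply H5 || apply H6 || apply Hd || apply Hd'.
    - destruct (Hpair a' a d d' l) as (k & k' & b & b' & H1 & H2 & H3 & H4 & H5 & H6 & H7 & H8); auto.
      exists (Conf d d' b' b k' k (S k')). cbn [act1 act2 wait1 wait2 left1 left2 low].
      rewrite Nat.min_r, Nat.max_l, Nat.ltb_ge by lia.
      repeat split; auto; lia || apply H3 || apply H4 || apply H5 || apply H6 || apply Hd || apply Hd'. }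
  set (a1 := fun n => act1 (f n)). set (a2 := fun n => act2 (f n)).
  (* The departures of stage [n] are stored in configuration [S n]. *)
  set (k1 := fun n => left1 (f (S n))). set (k2 := fun n => left2 (f (S n))).
  assert (Hinc : forall n, low (f n) <= k1 n < low (f (S n)) /\ low (f n) <= k2 n < low (f (S n))).
  { intros n. destruct (Hf n) as (_ & _ & _ & _ & _ & H1 & H2 & _). auto. }
  assert (Hk1 : forall n, k1 n < k1 (S n)) by (intros n; pose proof (Hinc n); pose proof (Hinc (S n)); lia).
  assert (Hk2 : forall n, k2 n < k2 (S n)) by (intros n; pose proof (Hinc n); pose proof (Hinc (S n)); lia).
  (* A real chosen at stage [n] waits for one stage and is active at stage [S (S n)], as the limit
     lemma requires. *)
  destruct (alternating_limits P a1 k1) as (c0 & c2 & P0 & P2 & L1); auto.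
  { intros n. apply (Hf n). }
  { intros n. destruct (Hf n) as (_ & _ & _ & H & _). destruct (Hf (S n)) as (_ & E & _).
    unfold a1. rewrite E. exact H. }
  destruct (alternating_limits P a2 k2) as (c1 & c3 & P1 & P3 & L2); auto.
  { intros n. apply (Hf n). }
  { intros n. destruct (Hf n) as (_ & _ & _ & _ & H & _). destruct (Hf (S n)) as (_ & _ & E & _).
    unfold a2. rewrite E. exact H. }
  assert (Hstart : low (f 0) = m /\ a1 0 = b0 /\ a2 0 = b0 /\ a1 1 = b0 /\ a2 1 = b0).
  { destruct (Hf 0) as (_ & E1 & E2 & _). unfold a1, a2. rewrite E1, E2, Hf0. auto. }
  destruct Hstart as (Hlow & E1 & E2 & E3 & E4).
  pose proof (Hinc 0) as Hm. rewrite Hlow in Hm.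
  pose proof (Hk1 0). pose proof (Hk2 0).
  exists c0, c1, c2, c3. split.
  - intros c Hc.
    assert (Hcyl : forall k b d, m <= k -> b = b0 -> agree_upto k b d -> agree_upto m z d).
    { intros k b d Hmk -> Hag r Hr. rewrite Hzb0 by exact Hr. apply Hag. lia. }
    destruct Hc as [<-|[<-|[<-|[<-|[]]]]]; (split; [assumption|]).
    + apply (Hcyl (k1 0) (a1 0)); [lia|exact E1|apply (L1 0)].
    + apply (Hcyl (k2 0) (a2 0)); [lia|exact E2|apply (L2 0)].
    + apply (Hcyl (k1 1) (a1 1)); [lia|exact E3|apply (L1 1)].
    + apply (Hcyl (k2 1) (a2 1)); [lia|exact E4|apply (L2 1)].
  - intros X Hx Hc.
    apply (decode X x y (fun n => if Nat.even n then c0 else c2) (fun n => if Nat.even n then c1 else c3)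
             a1 a2 k1 k2); auto.
    + apply uniformly_le_alternating; apply Hc; cbn; auto.
    + apply uniformly_le_alternating; apply Hc; cbn; auto 6.
    + rewrite E1. apply Hb0.
    + rewrite E2. apply Hb0.
    + intros n. destruct (Hf n) as (_ & F1 & F2 & _ & _ & _ & _ & _ & H1 & H2).
      unfold a1, a2. rewrite F1, F2. auto.
    + intros n. apply (Hf n).
Qed.

(** * Failure of independence after the exchange *)

Lemma classical_filter {T} (P : T -> Prop) (l : list T) :
  exists l', forall a, In a l' <-> In a l /\ P a.
Proof.
  induction l as [|h l [l' IH]].
  - exists []. cbn. tauto.
  - destruct (classic (P h)) as [Hh|Hh].
    + exists (h :: l'). intros a. cbn. rewrite IH. intuition congruence.
    + exists l'. intros a. cbn. rewrite IH. intuition congruence.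
Qed.

Theorem theorem1p3 (A A' B : rset) (x : real) :
  turing_independent A ->
  perfect_set A' -> subset A' A ->
  countable_set B -> dense_in B A' ->
  (forall b, B b -> turing_le b x) ->
  ~ turing_independent (fun y => (A y /\ ~ B y) \/ y = x).
Proof.
  intros _ Hperf HA _ [HBA HB] Hx Hind.
  assert (Hdense : dense_in (fun b => A' b /\ turing_le b x) A').
  { split; [intros b [H _]; exact H|]. intros z Hz n. destruct (HB z Hz n) as (b & Hb & H).
    exists b. auto. }
  assert (Hy : exists y, A' y /\ ~ turing_le y x).
  { apply NNPP. intros Hno. destruct (turing_incomplete x) as [u Hu].
    destruct Hperf as [[z Hz] Hperf'].
    (* If [x] computed all of [A'], it would compute the four coding reals and hence [u]. *)
    destruct (perfect_coding A' x u z 0) as (c0 & c1 & c2 & c3 & Hc & Hdec); auto.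
    { split; eauto. }
    apply Hu, Hdec; [apply turing_le_refl|]. intros c Hin. apply NNPP. intros Hn.
    apply Hno. exists c. split; [apply Hc, Hin | exact Hn]. }
  destruct Hy as (y & Hy & Hyx).
  destruct Hperf as (Hne & Hcl & Hiso).
  destruct (Hiso y Hy 0) as (z & Hz & Hzy & _).
  destruct (real_neq_least z y Hzy) as (k & _ & Hk).
  (* [z] differs from [y] at [k], so no real that agrees with [z] through [k] equals [y]. *)
  destruct (perfect_coding A' x y z (S k)) as (c0 & c1 & c2 & c3 & Hc & Hdec); auto.
  { split; auto. }
  (* The coding reals kept in [l] are not computable from [x], hence lie outside [B]; the others are
     recovered from [x], the head of the join. *)
  destruct (classical_filter (fun c => ~ turing_le c x) [c0; c1; c2; c3]) as [l Hl].
  apply (Hind x l y).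
  - auto.
  - intros c Hin. apply Hl in Hin as [Hin Hn]. left. split; [apply HA, Hc, Hin|]. auto.
  - left. auto.
  - intros ->. apply Hyx, turing_le_refl.
  - intros Hin. apply Hl in Hin as [Hin _]. apply Hc in Hin as [_ Hag]. apply Hk. symmetry.
    apply Hag. lia.
  - assert (Hxl : turing_le x (joinl x l)) by (apply turing_le_joinl; cbn; auto).
    apply Hdec; [exact Hxl|]. intros c Hin. destruct (classic (turing_le c x)) as [H|H].
    + exact (turing_le_trans _ _ _ H Hxl).
    + apply turing_le_joinl. right. apply Hl. auto.
Qed.
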